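(* Let $\alpha,\beta\in\mathbb{R}$. The sequence $\{k^2+\alpha k+\beta\}_{k=0}^{\infty}$ is a Legendre multiplier sequence if and only if $\alpha=1$ and $\beta\in[0,1]$.
   Context: The Legendre polynomials $\mathfrak{Le}_n(x)$ are defined by $\frac{1}{\sqrt{1-2xt+t^2}}=\sum_{k=0}^{\infty}\mathfrak{Le}_k(x)t^k$. A real sequence $\{\gamma_k\}_{k=0}^{\infty}$ is a Legendre multiplier sequence if, for every $n$ and all real $a_0,\dots,a_n$, the polynomial $\sum_{k=0}^n a_k\gamma_k\mathfrak{Le}_k(x)$ has only real zeros whenever $\sum_{k=0}^n a_k\mathfrak{Le}_k(x)$ has only real zeros. *)

(* Defs.v *)
From mathcomp Require Import all_boot all_order all_algebra.
From mathcomp Require Import reals.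
Set Implicit Arguments. Unset Strict Implicit. Unset Printing Implicit Defensive.
Import Order.TTheory GRing.Theory Num.Theory.
Local Open Scope ring_scope.

(* Legendre polynomials, via the (pair) recurrence equivalent to the
   generating function 1/sqrt(1-2xt+t^2) = sum_k Le_k(x) t^k :
   Le_0 = 1, Le_1 = X, (n+2) Le_{n+2} = (2n+3) X Le_{n+1} - (n+1) Le_n. *)
Fixpoint legendre_pair (R : fieldType) (n : nat) : {poly R} * {poly R} :=
  match n with
  | 0%N => (1, 'X)
  | n'.+1 =>
      let: (p, q) := legendre_pair R n' in
      (q, (n'.+2%:R)^-1 *: ((n'.*2.+3)%:R *: ('X * q) - (n'.+1)%:R *: p))
  end.

Definition legendre (R : fieldType) (n : nat) : {poly R} := (legendre_pair R n).1.

(* A real polynomial has only real zeros: it factors into linear factors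
   over R (the zero polynomial and nonzero constants included). *)
Definition real_rooted (R : realType) (p : {poly R}) : Prop :=
  exists rs : seq R, p = lead_coef p *: \prod_(r <- rs) ('X - r%:P).

Definition legendre_multiplier_sequence (R : realType) (g : nat -> R) : Prop :=
  forall (n : nat) (a : nat -> R),
    real_rooted (\sum_(k < n.+1) a k *: legendre R k) ->
    real_rooted (\sum_(k < n.+1) (a k * g k) *: legendre R k).

(* Main.v *)
(* By Legendre's equation, k^2 + k + b acts on Legendre expansions as the operator
   T p = (x^2 - 1) p'' + 2 x p' + b p.

   Sufficiency.  Let p have real zeros r, let z be nonreal and put u_r = 1 / (z - r),
   a = 1 / (z - 1), a' = 1 / (z + 1); all their imaginary parts have the same sign.
   Then T p (z) / ((z^2 - 1) p (z)) = e^2 - sum u_r^2 + e (a + a') + b a a', with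
   e = sum u_r.  For 0 <= b <= 1 this is a quadratic form of Lorentzian signature,
   evaluated at a vector whose imaginary part is timelike, so it does not vanish.

   Necessity.  Laguerre's inequality q q'' <= q'^2 for real-rooted q, applied at
   x = r to the image of (x - r)^4, forces alpha <= 1 (r = 0) and alpha >= 1 (r = 2).
   Then (x^2 - d)^2 with d = - 6 / beta excludes beta < 0, and (x - r)^N, whose image
   is (x - r)^(N-2) times a quadratic with negative discriminant for N and r large,
   excludes beta > 1. *)
Require Import Defs.
From mathcomp Require Import all_boot all_order all_algebra.
From mathcomp Require Import reals.
From mathcomp Require Import complex.
From mathcomp Require Import ring lra.
Import Order.TTheory GRing.Theory Num.Theory.
Local Open Scope ring_scope.

(** * Legendre polynomials: recurrence, differential equation, spanning *)

Lemma legendreS2 (R : numFieldType) (n : nat) :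
  n.+2%:R * legendre R n.+2 =
    n.*2.+3%:R * ('X * legendre R n.+1) - n.+1%:R * legendre R n.
Proof.
have E : legendre R n.+2 =
    (n.+2%:R)^-1 *: (n.*2.+3%:R *: ('X * legendre R n.+1)
                     - n.+1%:R *: legendre R n).
  by rewrite /legendre /=; case: (legendre_pair R n).
rewrite E mulr_natl -scaler_nat scalerA divff ?pnatr_eq0 // scale1r.
by rewrite !scaler_nat !mulr_natl.
Qed.

Lemma natr_poly_neq0 (R : numFieldType) (n : nat) : n.+1%:R != 0 :> {poly R}.
Proof. by rewrite -polyC_natr polyC_eq0 pnatr_eq0. Qed.

Lemma deriv_natrM (R : numFieldType) (n : nat) (p : {poly R}) :
  (n%:R * p)^`() = n%:R * p^`().
Proof. by rewrite !mulr_natl derivMn. Qed.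

(** The two identities are proved together: differentiating the recurrence expresses the next
    derivative through both of them. *)
Lemma legendre_deriv (R : numFieldType) (n : nat) :
  'X * (legendre R n.+1)^`() - (legendre R n)^`() = n.+1%:R * legendre R n.+1
  /\ (legendre R n.+1)^`() - 'X * (legendre R n)^`() = n.+1%:R * legendre R n.
Proof.
elim: n => [|n [IH1 IH2]].
  by rewrite /legendre /= derivX derivC; split; ring.
have rec := legendreS2 R n; move: rec IH1 IH2.
move: (legendre R n) (legendre R n.+1) (legendre R n.+2) => p q r rec IH1 IH2.
have drec := congr1 (@deriv R) rec.
move: drec; rewrite derivB !deriv_natrM derivM derivX mul1r.
have E3 : n.*2.+3%:R = 2 * n%:R + 3 :> {poly R}.
  by rewrite -addn3 natrD -mul2n natrM.
have E2 : n.+2%:R = n%:R + 2 :> {poly R} by rewrite -addn2 natrD.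
have E1 : n.+1%:R = n%:R + 1 :> {poly R} by rewrite -addn1 natrD.
move: (natr_poly_neq0 R n.+1) rec IH1 IH2; rewrite E3 E2 E1.
move: n%:R 'X => N X nz rec IH1 IH2 drec.
have dp : p^`() = X * q^`() - (N + 1) * q by rewrite -IH1; ring.
have key : r^`() - X * q^`() = (N + 2) * q.
  by apply: (mulfI nz); rewrite mulrBr drec dp; ring.
split=> //.
have -> : r^`() = X * q^`() + (N + 2) * q by rewrite -key; ring.
by rewrite rec -IH2 dp; ring.
Qed.

(** Defined over any commutative ring so as to be evaluated also at complex points, over [R[i]]. *)
Definition legendre_op {R : comNzRingType} (b : R) (p : {poly R}) : {poly R} :=
  ('X ^+ 2 - 1) * p^`()^`() + 2%:R * 'X * p^`() + b%:P * p.

Lemma legendre_op_legendre (R : numFieldType) (b : R) (k : nat) :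
  legendre_op b (legendre R k) = (k%:R ^+ 2 + k%:R + b) *: legendre R k.
Proof.
rewrite -mul_polyC /legendre_op !polyCD polyC_exp polyC_natr.
case: k => [|n]; first by rewrite /legendre /= !derivC; ring.
have [] := legendre_deriv R n.
move: (legendre R n) (legendre R n.+1) => p q IH1 IH2.
have first_order : ('X ^+ 2 - 1) * q^`() = n.+1%:R * ('X * q - p).
  rewrite mulrBr -IH2 mulrCA -IH1; ring.
have := congr1 (@deriv R) first_order.
rewrite deriv_natrM !(derivM, derivB, derivXn, derivX, derivC).
have E1 : n.+1%:R = n%:R + 1 :> {poly R} by rewrite -addn1 natrD.
move: IH1; rewrite E1; move: n%:R 'X => N X IH1 d1.
have dp : p^`() = X * q^`() - (N + 1) * q by rewrite -IH1; ring.
apply/eqP; rewrite -subr_eq0; apply/eqP.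
move/eqP: d1; rewrite -subr_eq0 => /eqP d1; rewrite -[RHS]d1 dp; ring.
Qed.

Lemma legendre_op_sum (R : numFieldType) (b : R) (n : nat) (a : nat -> R) :
  legendre_op b (\sum_(k < n) a k *: legendre R k) =
  \sum_(k < n) (a k * (k%:R ^+ 2 + k%:R + b)) *: legendre R k.
Proof.
elim: n => [|n IH].
  by rewrite !big_ord0 /legendre_op !deriv0 !mulr0 !addr0.
rewrite !big_ord_recr /= -IH -scalerA -legendre_op_legendre.
move: (\sum_(_ < _) _) (legendre R n) => p q.
by rewrite /legendre_op !(derivD, derivZ) -!mul_polyC; ring.
Qed.

(** Exact degree n makes the change of basis in [legendre_span] triangular. The induction carries
    two consecutive indices because the recurrence has order two. *)
Lemma legendre_coef (R : numFieldType) (n : nat) :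
  (forall i, (n < i)%N -> (legendre R n)`_i = 0) /\ (legendre R n)`_n != 0.
Proof.
have natM (m i : nat) (p : {poly R}) : (m%:R * p)`_i = m%:R * p`_i.
  by rewrite !mulr_natl coefMn.
suff [] : ((forall i, (n < i)%N -> (legendre R n)`_i = 0)
            /\ (legendre R n)`_n != 0)
       /\ ((forall i, (n.+1 < i)%N -> (legendre R n.+1)`_i = 0)
            /\ (legendre R n.+1)`_n.+1 != 0) by [].
elim: n => [|n [[z0 _] [z1 nz1]]].
  rewrite /legendre /=; split; split; rewrite ?coefC ?coefX ?oner_neq0 //.
    by case=> // i _; rewrite coefC.
  by case=> [|[|i]] // _; rewrite coefX.
split=> //; move: (legendreS2 R n) z0 z1 nz1.
move: (legendre R n) (legendre R n.+1) (legendre R n.+2) => p q r rec z0 z1 nz1.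
have coefE i : n.+2%:R * r`_i.+1 = n.*2.+3%:R * q`_i - n.+1%:R * p`_i.+1.
  by rewrite -!natM rec coefB !natM coefXM.
split=> [[|i]// lt_i|].
  have /eqP := coefE i; rewrite z0; last exact: leqW (ltnW lt_i).
  by rewrite z1 // !mulr0 subr0 mulf_eq0 pnatr_eq0 /= => /eqP.
have := coefE n.+1; rewrite z0 // mulr0 subr0 => e.
have : n.+2%:R * r`_n.+2 != 0 by rewrite e mulf_neq0 ?pnatr_eq0.
by rewrite mulf_eq0 negb_or => /andP[].
Qed.

Lemma legendre_span (R : numFieldType) (n : nat) (p : {poly R}) :
  (size p <= n)%N ->
  exists a : nat -> R, p = \sum_(k < n) a k *: legendre R k.
Proof.
elim: n p => [|n IH] p size_p.
  by exists (fun=> 0); rewrite big_ord0; apply/eqP; rewrite -size_poly_leq0.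
have [z nz] := legendre_coef R n.
pose c := p`_n / (legendre R n)`_n.
have [|a pE] := IH (p - c *: legendre R n).
  apply/leq_sizeP => i; rewrite leq_eqVlt => /predU1P[<-|lt_ni].
    by rewrite coefB coefZ divfK // subrr.
  by rewrite coefB coefZ z // mulr0 subr0; apply/leq_sizeP: lt_ni.
exists (fun k => if k == n then c else a k).
rewrite big_ord_recr /= eqxx -[LHS](subrK (c *: legendre R n)) pE.
by congr (_ + _); apply: eq_bigr => i _; rewrite ltn_eqF.
Qed.

Lemma legendre_multiplier_op (R : realType) (b : R) :
  legendre_multiplier_sequence (fun k : nat => k%:R ^+ 2 + k%:R + b) <->
  (forall p : {poly R}, real_rooted p -> real_rooted (legendre_op b p)).
Proof.
split=> [mult p rr | pres n a rr].
  have [a pE] := legendre_span R (size p).+1 p (leqnSn _).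
  by rewrite pE legendre_op_sum; apply: mult; rewrite -pE.
by rewrite -(legendre_op_sum R b n.+1 a); apply: pres.
Qed.

(** * Consequences of real-rootedness *)

Lemma real_rooted_prod (R : realType) (c : R) (rs : seq R) :
  real_rooted (c *: \prod_(r <- rs) ('X - r%:P)).
Proof.
exists rs; rewrite lead_coefZ (monicP _) ?mulr1 //.
exact: monic_prod_XsubC.
Qed.

(** Induction on the roots: passing from p to (X - r) p turns p'^2 - p p'' into p^2 + (x - r)^2
    (p'^2 - p p''). *)
Lemma laguerre_inequality (R : realType) (q : {poly R}) (x : R) :
  real_rooted q -> q.[x] * q^`()^`().[x] <= q^`().[x] ^+ 2.
Proof.
case=> rs ->; move: (lead_coef q) => c {q}.
rewrite !derivZ !hornerZ exprMn mulrACA -expr2.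
apply: ler_wpM2l; first exact: sqr_ge0.
elim: rs => [|r rs IH]; first by rewrite big_nil !derivC !hornerE expr2 mulr0.
rewrite big_cons; move: (\prod_(_ <- _) _) IH => p IH.
rewrite !derivM derivB derivX derivC subr0 mul1r derivD derivM.
rewrite derivB derivX derivC subr0 mul1r !hornerE /=.
move: (p.[x]) (p^`().[x]) (p^`()^`().[x]) IH => u v w IH.
rewrite -subr_ge0 [leRHS](_ : _ = u ^+ 2 + (x - r) ^+ 2 * (v ^+ 2 - u * w)).
  by rewrite addr_ge0 ?sqr_ge0 // mulr_ge0 ?sqr_ge0 ?subr_ge0.
ring.
Qed.

(** A divisor of a product of linear factors is, up to a unit, the product of some of them. *)
Lemma real_rooted_factor_root (R : realType) (p q : {poly R}) :
  real_rooted (p * q) -> p * q != 0 -> size q != 1%N -> exists x, root q x.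
Proof.
case=> rs pqE pq0 size_q.
have : q %| \prod_(r <- rs) ('X - r%:P).
  rewrite -(dvdpZr _ _ (_ : lead_coef (p * q) != 0)) ?lead_coef_eq0 //.
  by rewrite -pqE dvdp_mull.
case/dvdp_prod_XsubC => m; move: (mask m rs) => [|x s] qE.
  by move: qE size_q; rewrite big_nil => /eqp_size ->; rewrite size_poly1.
by exists x; rewrite (eqp_root qE) big_cons rootM root_XsubC eqxx.
Qed.

(** * Necessity of alpha = 1, by quartics *)

Lemma legendre2E (R : numFieldType) :
  legendre R 2 = 2^-1%:P * (3%:R * 'X^2 - 1).
Proof.
have h : 2%:R * 2^-1%:P = 1 :> {poly R}.
  by rewrite -polyC_natr -polyCM divff ?pnatr_eq0.
apply: (mulfI (natr_poly_neq0 R 1)).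
rewrite (legendreS2 R 0 : _ = 3%:R * _ - _) /legendre /= [RHS]mulrA h.
by move: 'X => X; ring.
Qed.

Lemma legendre3E (R : numFieldType) :
  legendre R 3 = 2^-1%:P * (5%:R * 'X^3 - 3%:R * 'X).
Proof.
have h : 2%:R * 2^-1%:P = 1 :> {poly R}.
  by rewrite -polyC_natr -polyCM divff ?pnatr_eq0.
apply: (mulfI (natr_poly_neq0 R 2)).
rewrite (legendreS2 R 1 : _ = 5%:R * _ - _) legendre2E /legendre /=.
move: 'X 2^-1%:P h => X c h; apply/eqP; rewrite -subr_eq0.
rewrite (_ : _ - _ = 2%:R * X * (2%:R * c - 1)); last by ring.
by rewrite h subrr mulr0.
Qed.

Lemma legendre4E (R : numFieldType) :
  legendre R 4 = 8^-1%:P * (35%:R * 'X^4 - 30%:R * 'X^2 + 3%:R).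
Proof.
have h : 8%:R * 8^-1%:P = 1 :> {poly R}.
  by rewrite -polyC_natr -polyCM divff ?pnatr_eq0.
have h2 : 2^-1%:P = 4%:R * 8^-1%:P :> {poly R}.
  by rewrite -polyC_natr -polyCM; congr _%:P; field.
apply: (mulfI (natr_poly_neq0 R 3)).
rewrite (legendreS2 R 2 : _ = 7%:R * _ - _) legendre2E legendre3E h2.
by move: 'X 8^-1%:P h => X c h; ring.
Qed.

Lemma legendre_sum5 (R : numFieldType) (g : nat -> R) :
  \sum_(k < 5) g k *: legendre R k =
    (3 / 8 * g 4 - g 2 / 2 + g 0)%:P + (g 1 - 3 / 2 * g 3) *: 'X
    + (3 / 2 * g 2 - 15 / 4 * g 4) *: 'X^2 + (5 / 2 * g 3) *: 'X^3
    + (35 / 8 * g 4) *: 'X^4.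
Proof.
rewrite !big_ord_recr big_ord0 /= legendre2E legendre3E legendre4E /legendre /=.
(* With 8 as the only denominator, [ring] can treat its inverse as a variable. *)
have -> : 2^-1 = 4%:R / 8 :> R by field.
have -> : 4^-1 = 2%:R / 8 :> R by field.
by rewrite -!mul_polyC; move: 'X 8^-1 => X c; ring.
Qed.

Lemma laguerre_quartic (R : realType) (c0 c1 c2 c3 c4 x : R) :
  real_rooted (c0%:P + c1 *: 'X + c2 *: 'X^2 + c3 *: 'X^3 + c4 *: 'X^4) ->
  (c0 + c1 * x + c2 * x ^+ 2 + c3 * x ^+ 3 + c4 * x ^+ 4)
    * (2 * c2 + 6 * c3 * x + 12 * c4 * x ^+ 2)
  <= (c1 + 2 * c2 * x + 3 * c3 * x ^+ 2 + 4 * c4 * x ^+ 3) ^+ 2.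
Proof.
move=> /(laguerre_inequality _ _ x); congr (_ * _ <= _ ^+ 2).
- by rewrite !(hornerD, hornerZ, hornerXn, hornerX, hornerC).
- rewrite !(derivD, derivZ, derivXn, derivX, derivC, derivMn) /=.
  rewrite !(hornerD, hornerZ, hornerMn, hornerXn, hornerX, hornerC) /=; ring.
- rewrite !(derivD, derivZ, derivXn, derivX, derivC, derivMn) /=.
  rewrite !(hornerD, hornerZ, hornerMn, hornerXn, hornerX, hornerC) /=; ring.
Qed.

(** The factors are Q(r), Q''(r) and Q'(r) for the image Q of 35 (x - r)^4. Write the sequence as
    (k^2 + k + be) + (al - 1) k: the first summand acts as T, which contributes only 840 (r^2 - 1)
    to Q''(r) because the zero at r is fourfold. *)
Lemma legendre_multiplier_quartic (R : realType) (al be r : R) :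
  legendre_multiplier_sequence (fun k : nat => k%:R ^+ 2 + al * k%:R + be) ->
  (- 8 * (al - 1) * (4 * r ^+ 2 + 1)) * (840 * (r ^+ 2 - 1) - 120 * (al - 1))
    <= (48 * (al - 1) * r) ^+ 2.
Proof.
(* Legendre coordinates of 35 (x - r)^4. *)
pose a := nth (0 : R) [:: 35 * r ^+ 4 + 70 * r ^+ 2 + 7;
  - 140 * r ^+ 3 - 84 * r; 140 * r ^+ 2 + 20; - 56 * r; 8].
have aE : \sum_(k < 5) a k *: legendre R k =
          35 *: \prod_(s <- [:: r; r; r; r]) ('X - s%:P).
  rewrite legendre_sum5 /a /= !big_cons big_nil.
  rewrite [X in X%:P](_ : _ = 35 * r ^+ 4); last by field.
  rewrite [X in X *: 'X](_ : _ = - 140 * r ^+ 3); last by field.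
  rewrite [X in X *: 'X^2](_ : _ = 210 * r ^+ 2); last by field.
  rewrite [X in X *: 'X^3](_ : _ = - 140 * r); last by field.
  rewrite [X in X *: 'X^4](_ : _ = 35); last by field.
  by rewrite -!mul_polyC; move: 'X => X; ring.
move=> /(_ 4 a); rewrite aE => /(_ (real_rooted_prod _ _ _)).
rewrite [X in real_rooted X]
  (legendre_sum5 _ (fun k => a k * (k%:R ^+ 2 + al * k%:R + be))).
move=> /(laguerre_quartic _ _ _ _ _ _ r).
rewrite /a /=; congr (_ * _ <= _ ^+ 2); by field.
Qed.

Lemma legendre_multiplier_linear_coef (R : realType) (al be : R) :
  legendre_multiplier_sequence (fun k : nat => k%:R ^+ 2 + al * k%:R + be) ->
  al = 1.
Proof.
move=> mult; have := legendre_multiplier_quartic R al be 0 mult.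
have := legendre_multiplier_quartic R al be 2 mult.
(* With t = al - 1, [h0] reads t (t + 7) <= 0 and [h2] reads 148 t^2 <= 7140 t. *)
move=> h2 h0; apply/eqP; rewrite eq_le.
by apply/andP; split; rewrite leNgt; apply/negP => lt_al; nra.
Qed.

(** * Necessity of 0 <= beta <= 1 *)

Lemma legendre_op_coef_ge0 (R : realType) (b : R) :
  (forall p : {poly R}, real_rooted p -> real_rooted (legendre_op b p)) ->
  0 <= b.
Proof.
move=> pres; rewrite leNgt; apply/negP => b_lt0.
(* With b d = -6 the image of (x^2 - d)^2 is (20 + b) x^4 - 12 d x^2 - 2 d. At 0 its value and
   second derivative are negative and its first derivative vanishes, against Laguerre. *)
pose d := - 6 / b; have bd : b * d = - 6 by rewrite /d mulrC divfK ?lt_eqF.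
have d_gt0 : 0 < d by nra.
pose s := Num.sqrt d; have sd : s ^+ 2 = d by rewrite sqr_sqrtr ?ltW.
have := pres _ (real_rooted_prod _ 1 [:: s; s; - s; - s]).
rewrite [X in legendre_op _ X]
  (_ : _ = 'X^4 - (2 * d) *: 'X^2 + (d ^+ 2)%:P); last first.
  rewrite !big_cons big_nil -sd -!mul_polyC; move: 'X => X; ring.
rewrite /legendre_op (_ : _ + _ = (- 2 * d)%:P + 0 *: 'X + (- 12 * d) *: 'X^2
    + 0 *: 'X^3 + (20 + b) *: 'X^4); last first.
  rewrite !(derivD, derivN, derivZ, derivXn, derivX, derivC, derivMn) /=.
  have -> : (- 2 * d)%:P = (4 * d + (b * d) * d)%:P.
    by rewrite bd; congr _%:P; ring.
  have -> : - 12 * d = - 12 - 12 * d - 2 * (b * d) by rewrite bd; ring.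
  rewrite -!mul_polyC; move: 'X => X; ring.
move=> /(laguerre_quartic _ _ _ _ _ _ 0); nra.
Qed.

Lemma legendre_op_expn (R : realType) (b r : R) (m : nat) :
  legendre_op b (('X - r%:P) ^+ m.+2) = ('X - r%:P) ^+ m *
    (('X ^+ 2 - 1) * (m.+2 * m.+1)%:R + 2%:R * m.+2%:R * 'X * ('X - r%:P)
     + b%:P * ('X - r%:P) ^+ 2).
Proof.
have dX n : (('X - r%:P) ^+ n.+1)^`() = n.+1%:R * ('X - r%:P) ^+ n.
  by rewrite deriv_exp derivB derivX derivC subr0 mul1r mulr_natl.
rewrite /legendre_op dX deriv_natrM dX natrM !exprS.
by move: 'X (_ ^+ m) => X Y; ring.
Qed.

Lemma legendre_op_coef_le1 (R : realType) (b : R) :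
  (forall p : {poly R}, real_rooted p -> real_rooted (legendre_op b p)) ->
  b <= 1.
Proof.
move=> pres; rewrite leNgt; apply/negP => b_gt1.
(* N > b / (b - 1) makes k = b N - N - b positive. *)
have [m m_big] : exists m : nat, b / (b - 1) < m%:R.
  exists (Num.truncn (b / (b - 1))).+1.
  by rewrite truncnS_gt.
pose N : R := m.+2%:R; have NE : N = m%:R + 2 by rewrite /N -addn2 natrD.
have m_ge0 : 0 <= m%:R :> R by exact: ler0n.
have k_gt0 : 0 < b * N - N - b.
  by move: m_big; rewrite ltr_pdivrMr ?subr_gt0 // NE; nra.
(* A quarter of the discriminant of [quad] is -N (r^2 k - K). The chosen r satisfies r >= 1 and r k
   = k + K, hence r^2 k > K. *)
pose K := (N - 1) * (N ^+ 2 + N + b).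
pose r := 1 + K / (b * N - N - b).
have K_ge0 : 0 <= K by rewrite mulr_ge0 //; nra.
have rk : r * (b * N - N - b) = b * N - N - b + K.
  by rewrite mulrDl mul1r divfK ?gt_eqF.
have r_ge1 : 1 <= r by rewrite lerDl divr_ge0 // ltW.
have r2k : K < r ^+ 2 * (b * N - N - b) by nra.
pose quad := ('X ^+ 2 - 1) * (m.+2 * m.+1)%:R
  + 2%:R * m.+2%:R * 'X * ('X - r%:P) + b%:P * ('X - r%:P) ^+ 2.
have quadE x : quad.[x] =
    (N ^+ 2 + N + b) * x ^+ 2 - 2 * (N + b) * r * x + b * r ^+ 2 - N * (N - 1).
  rewrite /quad -!polyC_natr.
  rewrite !(hornerD, hornerN, hornerM, horner_exp, hornerX, hornerC) natrM -/N.
  have -> : m.+1%:R = N - 1 by rewrite NE -addn1 natrD; ring.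
  ring.
have quad_gt0 x : 0 < quad.[x].
  have A_gt0 : 0 < N ^+ 2 + N + b by nra.
  (* Completing the square, with A the leading coefficient: A quad(x) = (A x - (N + b) r)^2 + N (r^2
     k - K). *)
  rewrite -(pmulr_rgt0 _ A_gt0) quadE.
  have := sqr_ge0 ((N ^+ 2 + N + b) * x - (N + b) * r).
  have : 0 < N * (r ^+ 2 * (b * N - N - b) - K).
    by rewrite mulr_gt0 ?subr_gt0 //; nra.
  rewrite /K; nra.
have quad_nz : quad != 0.
  by apply/eqP => q0; have := quad_gt0 0; rewrite q0 horner0 ltxx.
have := pres _ (real_rooted_prod _ 1 (nseq m.+2 r)).
rewrite big_nseq iter_mulr_1 scale1r legendre_op_expn -/quad.
case/real_rooted_factor_root.
- by rewrite mulf_neq0 // expf_neq0 // polyXsubC_eq0.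
(* The second difference of [quad] over -1, 0, 1 is 2 A > 0, so [quad] is not constant. *)
- apply/negP => /size_poly1P [c _ qc].
  have := quadE 0; have := quadE 1; have := quadE (-1).
  rewrite qc !hornerC => -> e1 e2; nra.
- by move=> x; rewrite /root gt_eqF.
Qed.

(** * Sufficiency, by excluding nonreal roots *)

Lemma real_rooted_complex (R : realType) (q : {poly R}) :
  (forall z : R[i], root (map_poly (real_complex R) q) z -> complex.Im z = 0) ->
  real_rooted q.
Proof.
have [->|nz] := eqVneq q 0; first by exists [::]; rewrite lead_coef0 scale0r.
move=> real_roots; set Q := map_poly (real_complex R) q in real_roots.
have [zs QE] := closed_field_poly_normal Q.
have lcQ : lead_coef Q = (lead_coef q)%:C%C by rewrite lead_coef_map.
exists (map (@complex.Re R) zs); apply: (map_inj_poly (@complexI R) (rmorph0 _)).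
rewrite -/Q {1}QE lcQ map_polyZ rmorph_prod big_map; congr (_ *: _).
apply: eq_big_seq => z zs_z; rewrite rmorphB /= map_polyX map_polyC /=.
have /real_roots : root Q z.
  rewrite QE rootZ ?root_prod_XsubC // lcQ fmorph_eq0 lead_coef_eq0 //.
by case: z {zs_z} => x y /= ->.
Qed.

(** Logarithmic differentiation: P'/P = S and P''/P = S^2 + S'. *)
Lemma deriv_prod_XsubC (F : fieldType) (rs : seq F) (z : F)
    (P := \prod_(r <- rs) ('X - r%:P)) (S := \sum_(r <- rs) (z - r)^-1) :
  z \notin rs ->
  P^`().[z] = P.[z] * S /\
  P^`()^`().[z] = P.[z] * (S ^+ 2 - \sum_(r <- rs) (z - r)^-1 ^+ 2).
Proof.
rewrite {}/P {}/S; elim: rs => [|r rs IH].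
  by rewrite !big_nil !derivC !hornerE; split; ring.
rewrite inE negb_or !big_cons => /andP[zr /IH[]].
move: (\prod_(_ <- _) _) (\sum_(_ <- _) _) (\sum_(_ <- _) _) => P S1 S2 d1 d2.
rewrite !derivM derivB derivX derivC subr0 mul1r derivD derivM.
rewrite derivB derivX derivC subr0 mul1r.
rewrite !(hornerD, hornerM, hornerN, hornerX, hornerC) d1 d2.
have zr0 : z - r != 0 by rewrite subr_eq0.
by split; field.
Qed.

(* Here s1 + i t1 = e = sum u_r, (s2 - t2) + 2 i m = sum u_r^2, and the form is
   (e + (a + a') / 2)^2 - sum u_r^2 - (1 - c) ((a + a') / 2)^2 - c ((a - a') / 2)^2.
   Write it L^2 - M and take l = L s / L t.  If the form vanished at s + i t, then
   its value at s - l t would be (1 + l^2) times its value at t, which is positive;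
   but L (s - l t) = 0 makes it nonpositive. *)
Lemma lorentzian_neq0 (R : realFieldType) (s1 t1 s2 t2 m xa ya xb yb c : R) :
  (forall l, 0 <= s2 - 2 * l * m + l ^+ 2 * t2) -> t2 <= t1 ^+ 2 ->
  0 < t1 * ya -> 0 < t1 * yb -> 0 < ya * yb -> 0 <= c <= 1 ->
  (s1 ^+ 2 - t1 ^+ 2) - (s2 - t2) + (s1 * (xa + xb) - t1 * (ya + yb))
    + c * (xa * xb - ya * yb) = 0 ->
  2 * s1 * t1 - 2 * m + (s1 * (ya + yb) + t1 * (xa + xb))
    + c * (xa * yb + ya * xb) = 0 -> False.
Proof.
move=> psd t21 t1a t1b tab /andP[c0 c1] re0 im0.
have qt : 0 < t1 ^+ 2 - t2 + t1 * (ya + yb) + c * (ya * yb).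
  by have := mulr_ge0 c0 (ltW tab); nra.
have Lt : t1 + (ya + yb) / 2 != 0.
  apply/eqP => L0; have : t1 * (t1 + (ya + yb) / 2) = 0 by rewrite L0 mulr0.
  by have := sqr_ge0 t1; nra.
pose l := (s1 + (xa + xb) / 2) / (t1 + (ya + yb) / 2).
have L0 : s1 + (xa + xb) / 2 - l * (t1 + (ya + yb) / 2) = 0.
  by rewrite /l divfK // subrr.
(* Half-sum and half-difference of the last two coordinates of s - l t. *)
pose h := (xa - l * ya + (xb - l * yb)) / 2.
pose g := (xa - l * ya - (xb - l * yb)) / 2.
have : (1 + l ^+ 2) * (t1 ^+ 2 - t2 + t1 * (ya + yb) + c * (ya * yb))
    = (s1 + (xa + xb) / 2 - l * (t1 + (ya + yb) / 2)) ^+ 2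
      - (s2 - 2 * l * m + l ^+ 2 * t2) - (1 - c) * h ^+ 2 - c * g ^+ 2
      - ((s1 ^+ 2 - t1 ^+ 2) - (s2 - t2) + (s1 * (xa + xb) - t1 * (ya + yb))
         + c * (xa * xb - ya * yb))
      + l * (2 * s1 * t1 - 2 * m + (s1 * (ya + yb) + t1 * (xa + xb))
         + c * (xa * yb + ya * xb)).
  by rewrite /h /g; field.
rewrite L0 re0 im0 expr0n /= mulr0 addr0 subr0.
have := mulr_gt0 (ltr_pwDl ltr01 (sqr_ge0 l)) qt.
have := psd l; have := mulr_ge0 c0 (sqr_ge0 g).
have : 0 <= (1 - c) * h ^+ 2 by rewrite mulr_ge0 ?sqr_ge0 ?subr_ge0.
move: (_ * (_ + _)) => *; lra.
Qed.

(** For u_r = x_r + i v_r the witnesses are s2 = sum x_r^2, t2 = sum v_r^2 and m = sum x_r v_r. The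
    quadratic in l is sum (x_r - l v_r)^2, and t2 <= (sum v_r)^2 because the v_r share a sign. *)
Lemma half_plane_sums (R : rcfType) (I : Type) (rs : seq I)
    (u : I -> R[i]) (y : R) :
  (forall r, y * complex.Im (u r) < 0) ->
  exists s2 t2 m : R,
    [/\ \sum_(r <- rs) u r ^+ 2 = Complex (s2 - t2) (2 * m),
        forall l, 0 <= s2 - 2 * l * m + l ^+ 2 * t2,
        t2 <= complex.Im (\sum_(r <- rs) u r) ^+ 2,
        y * complex.Im (\sum_(r <- rs) u r) <= 0 &
        rs <> [::] -> y * complex.Im (\sum_(r <- rs) u r) < 0].
Proof.
move=> uneg; elim: rs => [|r rs [s2 [t2 [m [sE psd le_t le0 _]]]]].
  by exists 0, 0, 0; rewrite !big_nil /= subrr !mulr0; split=> // [l|];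
    rewrite ?mulr0 ?subr0 ?addr0 ?sqr_ge0.
rewrite !big_cons sE; move: le_t le0 (uneg r); move: (\sum_(_ <- _) u _) (u r).
move=> [s1 t1] [x v] /= le_t le0 ltv.
exists (s2 + x ^+ 2), (t2 + v ^+ 2), (m + x * v); split.
- by rewrite expr2; simpc; congr Complex; ring.
- move=> l; have := psd l; have := sqr_ge0 (x - l * v); nra.
- have : 0 <= t1 * v.
    have y2 : 0 < y ^+ 2.
      rewrite exprn_even_gt0 //=; apply: contraTneq ltv => ->.
      by rewrite mul0r ltxx.
    by rewrite -(pmulr_rge0 _ y2) expr2 mulrACA mulr_le0 // ltW.
  by move: le_t; nra.
- nra.
- by move=> _; nra.
Qed.

Lemma Im_invc_lt0 (R : rcfType) (w : R[i]) :
  complex.Im w != 0 -> complex.Im w * complex.Im w^-1 < 0.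
Proof.
case: w => x y /= y0.
have y2 : 0 < y ^+ 2 by rewrite exprn_even_gt0.
by rewrite mulrN oppr_lt0 mulrA -expr2 divr_gt0 // ltr_wpDl // sqr_ge0.
Qed.

Lemma map_legendre_op (R S : comNzRingType) (f : {rmorphism R -> S}) b p :
  map_poly f (legendre_op b p) = legendre_op (f b) (map_poly f p).
Proof.
rewrite /legendre_op.
rewrite !(rmorph_nat, rmorph1, rmorphXn, rmorphN, rmorphD, rmorphM) /=.
by rewrite !deriv_map map_polyC map_polyX.
Qed.

Lemma legendre_op_roots_real (R : realType) (b c : R) (rs : seq R) (z : R[i]) :
  0 <= b <= 1 -> c != 0 -> rs <> [::] ->
  root (map_poly (real_complex R)
          (legendre_op b (c *: \prod_(r <- rs) ('X - r%:P)))) z ->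
  complex.Im z = 0.
Proof.
move=> b01 c0 rs0; apply: contraTeq => y0.
have Im_sub (r : R) : complex.Im (z - r%:C%C) = complex.Im z.
  by case: z {y0} => x y /=; rewrite subr0.
have nz (r : R) : z - r%:C%C != 0.
  by apply: contra_neq y0 => e; rewrite -(Im_sub r) e.
have neg (r : R) : complex.Im z * complex.Im (z - r%:C%C)^-1 < 0.
  by rewrite -{1}(Im_sub r) Im_invc_lt0 // Im_sub.
pose cs := map (real_complex R) rs.
rewrite map_legendre_op map_polyZ rmorph_prod /=.
rewrite (eq_bigr (fun r : R => 'X - (r%:C%C)%:P)); last first.
  by move=> r _; rewrite rmorphB /= map_polyX map_polyC.
rewrite -(big_map (real_complex R) xpredT (fun r => 'X - r%:P)) -/cs.
have zcs : z \notin cs.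
  by apply/mapP => -[r _ zr]; have := nz r; rewrite zr subrr eqxx.
have [] := deriv_prod_XsubC _ cs z zcs.
have Pz : (\prod_(r <- cs) ('X - r%:P)).[z] != 0.
  by rewrite -/(root _ z) root_prod_XsubC.
move: (\prod_(_ <- cs) _) Pz => P Pz; rewrite !big_map => d1 d2.
have [s2 [t2 [m [sE psd le_t _ /(_ rs0) lt_t]]]] :=
  half_plane_sums R R rs (fun r : R => (z - r%:C%C)^-1) (complex.Im z) neg.
move: d1 d2; rewrite sE; move: (\sum_(_ <- _) _) le_t lt_t => S le_t lt_t d1 d2.
have e1 : 1%:C%C = 1 :> R[i] by [].
have eN1 : (- 1)%:C%C = - 1 :> R[i] by rewrite rmorphN.
(* The points 1 and -1 behave like further real roots, so a and a' lie in the same half-plane as the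
   u_r. *)
have := neg (- 1); have := nz (- 1); have := neg 1; have := nz 1.
rewrite eN1 opprK e1 => n1 neg1 n2 neg2; apply/negP => /rootP.
rewrite /legendre_op !derivZ.
rewrite !(hornerD, hornerN, hornerM, hornerZ, hornerXn, hornerX, hornerC) d1 d2.
move=> eq0.
pose S2 : R[i] := Complex (s2 - t2) (2 * m).
(* The equation T p (z) = 0 divided by c P(z) (z^2 - 1). *)
have : S * S - S2 + S * ((z - 1)^-1 + (z + 1)^-1)
       + b%:C%C * ((z - 1)^-1 * (z + 1)^-1) = 0.
  have c0' : c%:C%C != 0 by rewrite fmorph_eq0.
  have nzP : c%:C%C * P.[z] * ((z - 1) * (z + 1)) != 0 by rewrite !mulf_neq0.
  apply: (mulfI nzP); rewrite mulr0 -[RHS]eq0 -/S2; field.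
  by rewrite n1 n2.
rewrite /S2; clear eq0 d1 d2; move: neg1 neg2 le_t lt_t.
case: S (z - 1)^-1 (z + 1)^-1 => s1 t1 [xa ya] [xb yb] /= neg1 neg2 le_t lt_t.
simpc => /eqP; rewrite eq_complex /= => /andP[/eqP re0 /eqP im0].
have pos v w : complex.Im z * v < 0 -> complex.Im z * w < 0 -> 0 < v * w.
  move=> v0 w0; have y2 : 0 < complex.Im z ^+ 2 by rewrite exprn_even_gt0.
  by rewrite -(pmulr_rgt0 _ y2) expr2 mulrACA nmulr_rgt0.
apply: (lorentzian_neq0 _ s1 t1 s2 t2 m xa ya xb yb b psd le_t) => //.
- exact: pos.
- exact: pos.
- exact: pos.
- by rewrite -[RHS]re0; ring.
- by rewrite -[RHS]im0; ring.
Qed.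

Lemma legendre_op_real_rooted (R : realType) (b : R) (p : {poly R}) :
  0 <= b <= 1 -> real_rooted p -> real_rooted (legendre_op b p).
Proof.
move=> b01 [rs ->]; move: (lead_coef p) => c.
have [->|c0] := eqVneq c 0.
  exists [::]; rewrite scale0r /legendre_op !deriv0 !mulr0 !addr0.
  by rewrite lead_coef0 scale0r.
(* Without roots e = 0 and its imaginary part has no strict sign; the image is then the constant b
   c. *)
case: rs => [|r rs].
  rewrite big_nil /legendre_op derivZ derivC scaler0 deriv0 !mulr0 !add0r.
  rewrite mul_polyC scalerA.
  by have := real_rooted_prod _ (b * c) [::]; rewrite big_nil.
by apply: real_rooted_complex => z; apply: legendre_op_roots_real.
Qed.

Theorem theorem4p10 (R : realType) (alpha beta : R) :
  legendre_multiplier_sequence (fun k : nat => (k%:R) ^+ 2 + alpha * k%:R + beta)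
  <-> alpha = 1 /\ 0 <= beta <= 1.
Proof.
have mult1 : legendre_multiplier_sequence
      (fun k : nat => k%:R ^+ 2 + 1 * k%:R + beta) <->
    (forall p : {poly R}, real_rooted p -> real_rooted (legendre_op beta p)).
  have ext n a :
      \sum_(k < n) (a k * (k%:R ^+ 2 + 1 * k%:R + beta)) *: legendre R k =
      \sum_(k < n) (a k * (k%:R ^+ 2 + k%:R + beta)) *: legendre R k.
    by apply: eq_bigr => k _; rewrite mul1r.
  rewrite -legendre_multiplier_op.
  by split=> mult n a /mult; rewrite (ext n.+1 a).
split=> [mult | [-> b01]].
  have al1 := legendre_multiplier_linear_coef _ _ _ mult.
  move: mult; rewrite al1 mult1 => pres; split=> //.
  by rewrite legendre_op_coef_ge0 // legendre_op_coef_le1.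
by apply/mult1 => p; apply: legendre_op_real_rooted.
Qed.
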